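(* Let $\mathcal{C}$ and $\mathcal{D}$ be two arbitrary small categories. An equivalence $\alpha:\mathcal{C}\to\mathcal{D}$ is isomorphic (as a functor) to an isomorphism of categories $\mathcal{C}\to\mathcal{D}$ if and only if for every two objects $X$ of $\mathcal{C}$ and $Y$ of $\mathcal{D}$ such that $\alpha(X)=Y$, the sets $[X]$ and $[Y]$ are of equal cardinality.
   Context: A functor $F:\mathcal{C}\to\mathcal{D}$ is called an equivalence if it is full and faithful and every object of $\mathcal{D}$ is isomorphic to $F(A)$ for some object $A$ of $\mathcal{C}$. An isomorphism of categories is a functor having a two-sided inverse functor (strictly). Two functors $\mathcal{C}\to\mathcal{D}$ are isomorphic if there is a natural isomorphism between them. For an object $A$ of a category, $[A]$ denotes the class of all objects of that category that are isomorphic to $A$; so here $[X]$ is formed in $\mathcal{C}$ and $[Y]$ is formed in $\mathcal{D}$. *)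

(* Defs.v *)
From mathcomp Require Import all_boot.
From mathcomp Require Import boolp classical_sets functions cardinality.

Set Implicit Arguments.
Unset Strict Implicit.
Unset Printing Implicit Defensive.

(* A small category has a type of objects and types of morphisms; equality of
   objects and of morphisms is Leibniz equality (no setoids). *)
Record category := Category {
  obj :> Type;
  hom : obj -> obj -> Type;
  idm : forall A, hom A A;
  comp : forall A B C, hom B C -> hom A B -> hom A C;
  comp_id_l : forall A B (f : hom A B), comp (idm B) f = f;
  comp_id_r : forall A B (f : hom A B), comp f (idm A) = f;
  comp_assoc : forall A B C D (h : hom C D) (g : hom B C) (f : hom A B),
    comp h (comp g f) = comp (comp h g) f
}.

Record functor (C D : category) := Functor {
  fobj :> C -> D;
  fmap : forall A B : C, hom A B -> hom (fobj A) (fobj B);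
  fmap_id : forall A : C, fmap (idm A) = idm (fobj A);
  fmap_comp : forall (A B E : C) (g : hom B E) (f : hom A B),
    fmap (comp g f) = comp (fmap g) (fmap f)
}.

Definition functor_id (C : category) : functor C C :=
  @Functor C C (fun A => A) (fun A B f => f)
    (fun A => erefl) (fun A B E g f => erefl).

Section FunctorComp.
Variables (C D E : category) (G : functor D E) (F : functor C D).

Let map_GF (A B : C) (f : hom A B) : hom (G (F A)) (G (F B)) :=
  fmap G (fmap F f).

Lemma functor_comp_id (A : C) : map_GF (idm A) = idm (G (F A)).
Proof. by rewrite /map_GF !fmap_id. Qed.

Lemma functor_comp_comp (A B X : C) (g : hom B X) (f : hom A B) :
  map_GF (comp g f) = comp (map_GF g) (map_GF f).
Proof. by rewrite /map_GF !fmap_comp. Qed.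

Definition functor_comp : functor C E :=
  @Functor C E (fun A => G (F A)) map_GF functor_comp_id functor_comp_comp.

End FunctorComp.

Definition is_iso (C : category) (A B : C) (f : hom A B) : Prop :=
  exists g : hom B A, comp g f = idm A /\ comp f g = idm B.

Definition isomorphic (C : category) (A B : C) : Prop :=
  exists f : hom A B, is_iso f.

Definition iso_class (C : category) (A : C) : set C :=
  [set B | isomorphic B A]%classic.

Definition full (C D : category) (F : functor C D) : Prop :=
  forall (A B : C) (g : hom (F A) (F B)), exists f : hom A B, fmap F f = g.

Definition faithful (C D : category) (F : functor C D) : Prop :=
  forall A B : C, injective (@fmap C D F A B).

Definition is_equivalence (C D : category) (F : functor C D) : Prop :=
  [/\ full F, faithful F & forall Y : D, exists A : C, isomorphic Y (F A)].

(* Strict inverse: the composites are equal to, not merely isomorphic to, the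
   identity functors, on objects and on morphisms. *)
Definition is_cat_isomorphism (C D : category) (F : functor C D) : Prop :=
  exists G : functor D C,
    functor_comp G F = functor_id C /\ functor_comp F G = functor_id D.

Record nat_trans (C D : category) (F G : functor C D) := NatTrans {
  ncomp :> forall A : C, hom (F A) (G A);
  naturality : forall (A B : C) (f : hom A B),
    comp (ncomp B) (fmap F f) = comp (fmap G f) (ncomp A)
}.

Definition functors_isomorphic (C D : category) (F G : functor C D) : Prop :=
  exists eta : nat_trans F G, forall A : C, is_iso (eta A).

(* Main.v *)
Require Import Defs.
From mathcomp Require Import all_boot.
From mathcomp Require Import boolp classical_sets functions cardinality.

Local Open Scope card_scope.

(** An isomorphism of categories [beta] is a bijection on objects which
    preserves and reflects being isomorphic, so it maps the class of [X] onto
    the class of [beta X] bijectively; a natural isomorphism from [alpha] to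
    [beta] identifies the latter with the class of [alpha X].  This is
    [cat_isomorphism_card].

    Conversely, [alpha] induces a bijection between the isomorphism classes of
    objects of [C] and those of [D].  If corresponding classes have the same
    cardinality, choosing a bijection for every class and glueing these gives a
    bijection [phi] from the objects of [C] to those of [D] such that [phi A]
    is isomorphic to [alpha A] for all [A] ([bijection_near_equivalence]).
    Choose isomorphisms [e A : alpha A -> phi A] and transport [alpha] along
    them: [f : A -> B] goes to [e B \o alpha f \o (e A)^-1].  This is a functor
    [beta] with object map [phi], isomorphic to [alpha] by construction
    ([transport_functor]).  Being isomorphic to [alpha], it is full and
    faithful, and a full and faithful functor which is bijective on objects
    has a strict inverse ([bijective_ff_cat_isomorphism]).

    The strict inverse requires comparing morphisms whose endpoints are equal
    only propositionally.  All such comparisons are made between arrows bundled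
    with their endpoints. *)

(* Composition of morphisms, rather than of functions. *)
Local Notation comp := Defs.comp.

(** * Isomorphic objects *)

Section Isomorphic.
Context {C : category}.
Implicit Types X Y Z : C.

Lemma isomorphic_refl X : isomorphic X X.
Proof. by exists (idm X), (idm X); rewrite !comp_id_l. Qed.

Lemma isomorphic_sym {X Y} : isomorphic X Y -> isomorphic Y X.
Proof. by move=> [f [g [gf fg]]]; exists g, f. Qed.

Lemma comp_cancel_mid {X Y Z W : C} {f : hom X Y} {g : hom Y X}
    (k : hom X W) (h : hom Z X) :
  comp g f = idm X -> comp (comp k g) (comp f h) = comp k h.
Proof. by move=> gf; rewrite comp_assoc -(comp_assoc k) gf comp_id_r. Qed.

Lemma isomorphic_trans {X Y Z} :
  isomorphic X Y -> isomorphic Y Z -> isomorphic X Z.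
Proof.
move=> [f [f' [f'f ff']]] [g [g' [g'g gg']]].
by exists (comp g f), (comp f' g'); rewrite !comp_cancel_mid.
Qed.

Lemma iso_class_eq {X Y} : isomorphic X Y -> iso_class X = iso_class Y.
Proof.
move=> XY; apply/seteqP; split=> Z /= ZX; first exact: isomorphic_trans ZX XY.
exact: isomorphic_trans ZX (isomorphic_sym XY).
Qed.

Lemma iso_class_inj {X Y} : iso_class X = iso_class Y -> isomorphic X Y.
Proof.
by move=> XY; have : iso_class X X by [exact: isomorphic_refl]; rewrite XY.
Qed.

End Isomorphic.

Lemma functor_isomorphic {C D : category} (F : functor C D) {X Y : C} :
  isomorphic X Y -> isomorphic (F X) (F Y).
Proof.
move=> [f [g [gf fg]]]; exists (fmap F f), (fmap F g).
by rewrite -!fmap_comp gf fg !fmap_id.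
Qed.

Lemma ff_isomorphic {C D : category} {F : functor C D} {X Y : C} :
  full F -> faithful F -> isomorphic (F X) (F Y) -> isomorphic X Y.
Proof.
move=> Ffull Ffaith [f [g [gf fg]]].
have [f' f'E] := Ffull _ _ f; have [g' g'E] := Ffull _ _ g.
exists f', g'; split; apply: Ffaith; rewrite fmap_comp fmap_id.
  by rewrite f'E g'E.
by rewrite f'E g'E.
Qed.

(** * Bijections between sets *)

Lemma set_bij_card_eq {T U : Type} {A : set T} {B : set U} {f : T -> U} :
  set_bij A B f -> A #= B.
Proof. by move=> /Pbij[g _]; exact: pcard_eq g. Qed.

(** A default value extends the bijection to a function on all of [T]. *)
Lemma card_eq_set_bij {T U : Type} {A : set T} {B : set U} (y : U) :
  A #= B -> exists f : T -> U, set_bij A B f.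
Proof.
move=> /card_eqP[f]; exists (valLR y f).
exact: (@bij _ _ A B (valLR y f)).
Qed.

(** * Arrows bundled with their endpoints *)

Record arrow (C : category) := Arrow {
  source : C;
  target : C;
  arrow_hom : hom source target
}.
Arguments source {C}.
Arguments target {C}.
Arguments Arrow {C source target}.
Arguments arrow_hom {C}.

Section Arrow.
Context {C : category}.

Lemma Arrow_source {X Y X' Y' : C} {f : hom X Y} {f' : hom X' Y'} :
  Arrow f = Arrow f' -> X = X'.
Proof. by case. Qed.

Lemma Arrow_target {X Y X' Y' : C} {f : hom X Y} {f' : hom X' Y'} :
  Arrow f = Arrow f' -> Y = Y'.
Proof. by case. Qed.

(** Uniqueness of identity proofs on objects makes the endpoint equalities
    carried by the equality of bundles trivial. *)
Lemma Arrow_inj {X Y : C} : injective (@Arrow C X Y).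
Proof.
move=> f g fg.
pose cast (X' Y' : C) (p : X' = X) (q : Y' = Y) (h : hom X' Y') : hom X Y :=
  ecast Z (hom Z Y) p (ecast Z (hom X' Z) q h).
suff H (a : arrow C) : a = Arrow g ->
    forall (p : source a = X) (q : target a = Y),
    cast _ _ p q (arrow_hom a) = g by exact: (H _ fg erefl erefl).
move=> -> /= p q.
by rewrite (Prop_irrelevance p erefl) (Prop_irrelevance q erefl).
Qed.

Lemma Arrow_comp {X Y Z X' Y' Z' : C} {g : hom Y Z} {f : hom X Y}
    {g' : hom Y' Z'} {f' : hom X' Y'} :
  Arrow g = Arrow g' -> Arrow f = Arrow f' ->
  Arrow (comp g f) = Arrow (comp g' f').
Proof.
move=> gg' ff'.
have XX' : X = X' := Arrow_source ff'.
have YY' : Y = Y' := Arrow_target ff'.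
have ZZ' : Z = Z' := Arrow_target gg'.
by subst; rewrite (Arrow_inj _ _ gg') (Arrow_inj _ _ ff').
Qed.

End Arrow.

Section FunctorArrow.
Context {C D : category}.
Implicit Types F G : functor C D.

(** Equality of the object maps is read off from the identity arrows. *)
Lemma functor_ext F G :
  (forall (X Y : C) (f : hom X Y), Arrow (fmap F f) = Arrow (fmap G f)) ->
  F = G.
Proof.
case: F G => [Fo Fm F1 F2] [Go Gm G1 G2] /= FG.
have E : Fo = Go by apply/funext => X; exact: Arrow_source (FG _ _ (idm X)).
subst Go.
have E : Fm = Gm.
  apply: functional_extensionality_dep => X.
  apply: functional_extensionality_dep => Y.
  apply/funext => f; exact: Arrow_inj (FG _ _ f).
subst Gm.
by rewrite (Prop_irrelevance F1 G1) (Prop_irrelevance F2 G2).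
Qed.

Lemma functor_Arrow_inj F {X Y X' Y' : C} {f : hom X Y} {f' : hom X' Y'} :
  injective F -> faithful F ->
  Arrow (fmap F f) = Arrow (fmap F f') -> Arrow f = Arrow f'.
Proof.
move=> Finj Ffaith ff'.
have XX' : X = X' := Finj _ _ (Arrow_source ff').
have YY' : Y = Y' := Finj _ _ (Arrow_target ff').
by subst; rewrite (Ffaith _ _ _ _ (Arrow_inj _ _ ff')).
Qed.

Lemma full_Arrow F {X Y : C} {X' Y' : D} (g : hom X' Y') :
  full F -> F X = X' -> F Y = Y' ->
  exists f : hom X Y, Arrow (fmap F f) = Arrow g.
Proof. by move=> Ffull XX' YY'; subst; have [f <-] := Ffull _ _ g; exists f. Qed.

End FunctorArrow.

(** * Isomorphisms of categories *)

(** The inverse sends [g] to the morphism with image [g] as a bundled arrow;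
    functoriality and both inverse laws follow from injectivity on arrows. *)
Lemma bijective_ff_cat_isomorphism {C D : category} {F : functor C D} :
  full F -> faithful F -> injective F -> (forall Y : D, exists X, F X = Y) ->
  is_cat_isomorphism F.
Proof.
move=> Ffull Ffaith Finj /choice[G GK].
have inv (Y Y' : D) (g : hom Y Y') :
    {f : hom (G Y) (G Y') | Arrow (fmap F f) = Arrow g}.
  by apply: cid; exact: full_Arrow.
pose Gm Y Y' (g : hom Y Y') := sval (inv Y Y' g).
have GmK Y Y' (g : hom Y Y') : Arrow (fmap F (Gm _ _ g)) = Arrow g.
  exact: svalP (inv Y Y' g).
have Gm1 (Y : D) : Gm _ _ (idm Y) = idm (G Y).
  by apply/Arrow_inj/(functor_Arrow_inj F Finj Ffaith); rewrite GmK fmap_id GK.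
have Gm2 (Y1 Y2 Y3 : D) (g : hom Y2 Y3) (f : hom Y1 Y2) :
    Gm _ _ (comp g f) = comp (Gm _ _ g) (Gm _ _ f).
  apply/Arrow_inj/(functor_Arrow_inj F Finj Ffaith).
  by rewrite GmK fmap_comp; apply: Arrow_comp; rewrite GmK.
exists (@Functor D C G Gm Gm1 Gm2); split; apply: functor_ext => X Y f /=.
  by apply: (functor_Arrow_inj F Finj Ffaith); exact: GmK.
exact: GmK.
Qed.

Lemma cat_isomorphism_bijective {C D : category} {F : functor C D} :
  is_cat_isomorphism F ->
  exists G : functor D C, cancel F G /\ cancel G F.
Proof.
move=> [G [GF FG]]; exists G; split=> X.
  exact: (congr1 (fun H : functor C C => H X) GF).
exact: (congr1 (fun H : functor D D => H X) FG).
Qed.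

Lemma cat_isomorphism_card {C D : category} {F : functor C D} (X : C) :
  is_cat_isomorphism F -> iso_class X #= iso_class (F X).
Proof.
move=> /cat_isomorphism_bijective[G [FK GK]]; apply: (@set_bij_card_eq _ _ _ _ F).
split=> [Y|Y Z _ _|Y YFX]; first exact: functor_isomorphic.
  exact: (can_inj FK).
by exists (G Y); rewrite ?GK //= -[X]FK; exact: functor_isomorphic.
Qed.

(** * Transporting a functor along isomorphisms *)

Lemma transport_functor {C D : category} (F : functor C D) {phi : C -> D} :
  (forall X, isomorphic (F X) (phi X)) ->
  exists G : functor C D, fobj G = phi /\ functors_isomorphic F G.
Proof.
move=> iso.
have iso_pair X : {p : hom (F X) (phi X) * hom (phi X) (F X) |
    comp p.2 p.1 = idm _ /\ comp p.1 p.2 = idm _}.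
  by apply: cid; have [f [g gfK]] := iso X; exists (f, g).
pose e X := (sval (iso_pair X)).1; pose e' X := (sval (iso_pair X)).2.
have e'e X : comp (e' X) (e X) = idm _ := (svalP (iso_pair X)).1.
have ee' X : comp (e X) (e' X) = idm _ := (svalP (iso_pair X)).2.
pose Gm X Y (f : hom X Y) := comp (comp (e Y) (fmap F f)) (e' X).
have Gm1 X : Gm _ _ (idm X) = idm (phi X).
  by rewrite /Gm fmap_id comp_id_r ee'.
have Gm2 (X Y Z : C) (g : hom Y Z) (f : hom X Y) :
    Gm _ _ (comp g f) = comp (Gm _ _ g) (Gm _ _ f).
  by rewrite /Gm -(comp_assoc (e Y)) comp_cancel_mid // fmap_comp !comp_assoc.
exists (Functor Gm1 Gm2); split=> //.
have nat X Y (f : hom X Y) : comp (e Y) (fmap F f) = comp (Gm _ _ f) (e X).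
  by rewrite /Gm -[RHS]comp_assoc e'e comp_id_r.
by exists (@NatTrans _ _ F (Functor Gm1 Gm2) e nat) => X; exists (e' X).
Qed.

Section FunctorsIsomorphic.
Context {C D : category} {F G : functor C D}.
Hypothesis FG : functors_isomorphic F G.

Lemma functors_isomorphic_obj (X : C) : isomorphic (F X) (G X).
Proof. by have [eta etaP] := FG; exists (eta X). Qed.

(** Conjugation by the natural isomorphism identifies the action of [G] on
    morphisms with that of [F]. *)
Lemma functors_isomorphic_full : full F -> full G.
Proof.
move=> Ffull X Y g; have [eta etaP] := FG.
have [e' [e'e ee']] := etaP X; have [i' [i'i ii']] := etaP Y.
have [f fE] := Ffull X Y (comp i' (comp g (eta X))); exists f.
by rewrite -[LHS]comp_id_r -ee' comp_assoc -naturality fE !comp_assoc ii'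
  comp_id_l -comp_assoc ee' comp_id_r.
Qed.

Lemma functors_isomorphic_faithful : faithful F -> faithful G.
Proof.
move=> Ffaith X Y f g fg; have [eta etaP] := FG; apply: Ffaith.
have [i' [i'i _]] := etaP Y.
by rewrite -[LHS]comp_id_l -[RHS]comp_id_l -i'i -!comp_assoc !naturality fg.
Qed.

End FunctorsIsomorphic.

(** * The bijection on objects *)

(** The bijection chosen for the class of [X] must not depend on the
    representative [X], so the choice is indexed by subsets of [C]. *)
Lemma bijection_near_equivalence {C D : category} {F : functor C D} :
  is_equivalence F -> (forall X : C, iso_class X #= iso_class (F X)) ->
  exists phi : C -> D, [/\ injective phi, forall Y, exists X, phi X = Y &
    forall X, isomorphic (F X) (phi X)].
Proof.
move=> [Ffull Ffaith Fsurj] card.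
have /choice[b bP] (S : set C) : exists f : C -> D,
    forall X, S = iso_class X -> set_bij S (iso_class (F X)) f.
  have [[X SX]|noX] := pselect (exists X, S = iso_class X); last first.
    (* Not an isomorphism class: any function [C -> D] will do. *)
    by exists F => X SX; case: noX; exists X.
  have [f fP] := card_eq_set_bij (F X) (card X).
  exists f => Y SY; rewrite SX.
  suff <- : iso_class (F X) = iso_class (F Y) by [].
  by apply/iso_class_eq/functor_isomorphic/iso_class_inj; rewrite -SX.
pose phi X := b (iso_class X) X.
have phi_iso X : isomorphic (F X) (phi X).
  have [bfun _ _] := bP _ X erefl.
  exact/isomorphic_sym/bfun/isomorphic_refl.
exists phi; split=> // [X Y phiXY|Y].
  have XY : isomorphic X Y.
    apply: (ff_isomorphic Ffull Ffaith); apply: isomorphic_trans (phi_iso X) _.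
    by rewrite phiXY; exact: isomorphic_sym.
  have [_ binj _] := bP _ Y erefl.
  apply: binj; rewrite ?inE //; first exact: isomorphic_refl.
  by rewrite -[in LHS](iso_class_eq XY).
have [X YFX] := Fsurj Y.
have [_ _ bsurj] := bP _ X erefl.
have [Z /= ZX <-] := bsurj Y YFX.
by exists Z; rewrite /phi (iso_class_eq ZX).
Qed.

Theorem theorem1 (C D : category) (alpha : functor C D)
    (alpha_equiv : is_equivalence alpha) :
  (exists beta : functor C D,
     is_cat_isomorphism beta /\ functors_isomorphic alpha beta)
  <->
  (forall (X : C) (Y : D), alpha X = Y -> iso_class X #= iso_class Y).
Proof.
split=> [[beta [beta_iso ab]] X Y <-|card].
  rewrite (iso_class_eq (functors_isomorphic_obj ab X)).
  exact: cat_isomorphism_card.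
have [phi [phi_inj phi_surj phi_iso]] :=
  bijection_near_equivalence alpha_equiv (fun X => card X _ erefl).
have [beta [betaE ab]] := transport_functor alpha phi_iso.
have [afull afaith _] := alpha_equiv.
exists beta; split=> //; apply: bijective_ff_cat_isomorphism.
- exact: functors_isomorphic_full ab afull.
- exact: functors_isomorphic_faithful ab afaith.
- by rewrite betaE.
- by rewrite betaE.
Qed.
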